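(* Let $\Omega=\Omega_1\times\dots\times\Omega_m\subseteq\mathbb{R}^n$ be closed and convex, let $f$ be a real-valued continuously differentiable function on $\Omega$, let $S=S_1\times\dots\times S_m$ be compact, and let $h_\sigma(x,y)=\sum_{i=1}^m h^i_{\sigma_i}(x_i,y)$ be a block-separable metric function whose components satisfy (BH1)--(BH3) as described in the context. Let $\{x^{(k)}\}_{k\in\mathbb{N}}$ be a sequence generated by the Cyclic Block Generalized Gradient Projection Method described in the context, with partial updates $z(k,i)$, $i=0,\dots,m$, and assume that $\bar x$ is a limit point of $\{x^{(k)}\}_{k\in\mathbb{N}}$. Then $\bar x$ is a limit point also of the sequence $\{z(k,i)\}_{k\in\mathbb{N}}$ for every $i=1,\dots,m-1$, and $\bar x$ is a stationary point of the problem $\min_{x\in\Omega}f(x)$.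
   Context: Setting: $\Omega=\Omega_1\times\dots\times\Omega_m$ is closed and convex, $\Omega_i\subseteq\mathbb{R}^{n_i}$, $\sum_{i=1}^m n_i=n$; every $x\in\Omega$ is partitioned as $x=(x_1,\dots,x_m)$ with $x_i\in\Omega_i$. $\nabla_i f$ is the gradient of $f$ with respect to the $i$-th block, and $\nabla_1$ the gradient with respect to the first argument. A point $x\in\Omega$ is stationary for $\min_{x\in\Omega}f(x)$ if $\nabla f(x)^T(y-x)\ge0$ for all $y\in\Omega$. A limit point of a sequence is the limit of one of its subsequences. Block-separable metric function: $S=S_1\times\dots\times S_m$ with $S_i\subset\mathbb{R}^{q_i}$, $\sigma=(\sigma_1,\dots,\sigma_m)\in S$, and $h_\sigma(x,y)=\sum_{i=1}^m h^i_{\sigma_i}(x_i,y)$, where each $h^i_{\sigma_i}:\Omega_i\times\Omega\to\mathbb{R}$ is continuously differentiable and, for all $\sigma_i\in S_i$: (BH1) $h^i_{\sigma_i}$ is convex with respect to its first argument and, for every $x\in\Omega$, $h^i_{\sigma_i}(\cdot,x)$ admits a unique minimum point on $\Omega_i$; (BH2) for any $x\in\Omega$ and any $d\in\mathbb{R}^{n_i}$ with $x_i+d\in\Omega_i$, $\nabla_1 h^i_{\sigma_i}(x_i,x)^Td=\nabla_i f(x)^Td$; (BH3) $h^i_{\sigma_i}$ depends continuously on $\sigma_i$, in the sense that $(\sigma_i,u,x)\mapsto h^i_{\sigma_i}(u,x)$ is continuous on $S_i\times\Omega_i\times\Omega$. The block generalized projection is $p_i(x;h^i_{\sigma_i})=\arg\min_{u\in\Omega_i}h^i_{\sigma_i}(u,x)$.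 Cyclic Block Generalized Gradient Projection Method: $S$ is compact, $\beta,\delta\in(0,1)$, $x^{(0)}\in\Omega$, and $L_1,\dots,L_m$ are positive integers. For $k=0,1,2,\dots$: 1. Set $z(k,0)=x^{(k)}$. 2. For $i=1,\dots,m$: set $x_i^{(k,0)}=x_i^{(k)}$; choose an integer $L_i^{(k)}$ with $1\le L_i^{(k)}\le L_i$; for $\ell=0,\dots,L_i^{(k)}-1$: - set $\tilde x^{(k,\ell)}=(x_1^{(k+1)},\dots,x_{i-1}^{(k+1)},x_i^{(k,\ell)},x_{i+1}^{(k)},\dots,x_m^{(k)})$; - choose (arbitrarily) $\sigma_i^{(k,\ell)}\in S_i$; - set $d_i^{(k,\ell)}=p_i(\tilde x^{(k,\ell)};h^i_{\sigma_i^{(k,\ell)}})-x_i^{(k,\ell)}$ and $\tilde d^{(k,\ell)}=(0,\dots,0,d_i^{(k,\ell)},0,\dots,0)$ (nonzero only in block $i$); - Armijo linesearch: let $\lambda_i^{(k,\ell)}$ be the first element $\lambda$ of $1,\delta,\delta^2,\dots$ satisfying $f(\tilde x^{(k,\ell)}+\lambda\tilde d^{(k,\ell)})\le f(\tilde x^{(k,\ell)})+\beta\lambda\nabla_i f(\tilde x^{(k,\ell)})^Td_i^{(k,\ell)}$; - set $x_i^{(k,\ell+1)}=x_i^{(k,\ell)}+\lambda_i^{(k,\ell)}d_i^{(k,\ell)}$. Then set $x_i^{(k+1)}=x_i^{(k,L_i^{(k)})}$ and $z(k,i)=(x_1^{(k+1)},\dots,x_i^{(k+1)},x_{i+1}^{(k)},\dots,x_m^{(k)})$.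 3. Set $x^{(k+1)}=z(k,m)$. *)

(* Defs.v *)
From mathcomp Require Import all_boot all_order all_algebra.
From mathcomp Require Import all_classical all_reals all_analysis.

Set Implicit Arguments.
Unset Strict Implicit.
Unset Printing Implicit Defensive.

Import Order.TTheory GRing.Theory Num.Theory.
Import numFieldNormedType.Exports.

Local Open Scope classical_set_scope.
Local Open Scope ring_scope.

Section Euclidean.
Context {R : realType}.

Definition dot {N : nat} (u v : 'rV[R]_N) : R := (u *m v^T) 0 0.

(* C^1 regularity of a function on a set A that may have empty interior:
   the first-order expansion is only required along y in A, and g is
   continuous for the subspace topology of A. For A convex, dot (g x) (y - x)
   with x, y in A does not depend on the choice of g. The values of f and g
   outside A are irrelevant. *)
Definition C1_on {N : nat} (A : set 'rV[R]_N)
    (f : 'rV[R]_N -> R) (g : 'rV[R]_N -> 'rV[R]_N) : Prop :=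
  (forall x, A x -> forall eps : R, 0 < eps ->
     \forall y \near within A (nbhs x),
       `|f y - f x - dot (g x) (y - x)| <= eps * `|y - x|) /\
  {within A, continuous g}.

Definition min_points {N : nat} (A : set 'rV[R]_N) (f : 'rV[R]_N -> R) :
    set 'rV[R]_N :=
  [set u | A u /\ forall v, A v -> f u <= f v].

Definition stationary {N : nat} (A : set 'rV[R]_N)
    (g : 'rV[R]_N -> 'rV[R]_N) (x : 'rV[R]_N) : Prop :=
  A x /\ forall y, A y -> 0 <= dot (g x) (y - x).

Definition subseq_limit_point {N : nat} (u : nat -> 'rV[R]_N) (x : 'rV[R]_N) : Prop :=
  exists2 phi : nat -> nat, increasing_seq phi & u (phi k) @[k --> \oo] --> x.

End Euclidean.

Section Blocks.
Context {R : realType} {m : nat}.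

(* R^(n_1 + ... + n_m) is 'rV[R]_(\sum_i n i); the i-th block of x is
   submxrow x i, with i : 'I_m numbered from 0. *)
Definition block_prod {n : 'I_m -> nat} (A : forall i, set 'rV[R]_(n i)) :
    set 'rV[R]_(\sum_i n i) :=
  [set x | forall i, A i (submxrow x i)].

Definition block_inj {n : 'I_m -> nat} (i : 'I_m) (d : 'rV[R]_(n i)) :
    'rV[R]_(\sum_i n i) :=
  \mxrow_j dfwith (fun j => 0 : 'rV[R]_(n j)) i d j.

End Blocks.

Section Method.
Context {R : realType} {m : nat} {n q : 'I_m -> nat}.
Notation X := 'rV[R]_(\sum_i n i).

(* h i s u x is h^i_s(u, x). The function of the pair (u, x) is encoded as a
   function of the concatenation row_mx u x, and gradh i s is its full
   gradient, so that lsubmx (gradh i s (row_mx u x)) is the gradient with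
   respect to the first argument. *)
Record block_separable_metric
    (Om : forall i, set 'rV[R]_(n i)) (S : forall i, set 'rV[R]_(q i))
    (gradf : X -> X)
    (hs : 'rV[R]_(\sum_i q i) -> X -> X -> R)
    (h : forall i, 'rV[R]_(q i) -> 'rV[R]_(n i) -> X -> R)
    (gradh : forall i, 'rV[R]_(q i) ->
       'rV[R]_(n i + \sum_j n j) -> 'rV[R]_(n i + \sum_j n j)) : Prop := {
  bsm_sum : forall s x y,
    block_prod S s -> block_prod Om x -> block_prod Om y ->
    hs s x y = \sum_i h i (submxrow s i) (submxrow x i) y ;
  bsm_C1 : forall i s, S i s ->
    C1_on [set w | Om i (lsubmx w) /\ block_prod Om (rsubmx w)]
          (fun w => h i s (lsubmx w) (rsubmx w)) (gradh i s) ;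
  bsm_convex : forall i s x, S i s -> block_prod Om x ->
    convex_function (Om i) (fun u => h i s u x) ;
  bsm_unique_min : forall i s x, S i s -> block_prod Om x ->
    exists! u, min_points (Om i) (fun u => h i s u x) u ;
  bsm_grad : forall i s x d, S i s -> block_prod Om x ->
    Om i (submxrow x i + d) ->
    dot (lsubmx (gradh i s (row_mx (submxrow x i) x))) d =
    dot (submxrow (gradf x) i) d ;
  bsm_continuous : forall i,
    {within S i `*` (Om i `*` block_prod Om),
      continuous (fun w : 'rV[R]_(q i) * ('rV[R]_(n i) * X) =>
                    h i w.1 w.2.1 w.2.2)} }.

(* The argmin of f over A; get picks an arbitrary point if there is none. *)
Definition argmin {N : nat} (A : set 'rV[R]_N) (f : 'rV[R]_N -> R) :
    'rV[R]_N := get (min_points A f).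

Definition block_proj (Om : forall i, set 'rV[R]_(n i))
    (h : forall i, 'rV[R]_(q i) -> 'rV[R]_(n i) -> X -> R)
    (i : 'I_m) (x : X) (s : 'rV[R]_(q i)) : 'rV[R]_(n i) :=
  argmin (Om i) (fun u => h i s u x).

Definition armijo (f : X -> R) (gradf : X -> X) (beta : R) (x : X)
    (i : 'I_m) (d : 'rV[R]_(n i)) (lambda : R) : Prop :=
  f (x + lambda *: block_inj d) <=
  f x + beta * lambda * dot (submxrow (gradf x) i) d.

Definition armijo_step (f : X -> R) (gradf : X -> X) (beta delta : R) (x : X)
    (i : 'I_m) (d : 'rV[R]_(n i)) (lambda : R) : Prop :=
  exists j : nat, [/\ lambda = delta ^+ j,
    armijo f gradf beta x d (delta ^+ j) &
    forall j', (j' < j)%N -> ~ armijo f gradf beta x d (delta ^+ j')].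

(* (x_1^(k+1), ..., x_{i-1}^(k+1), x_i^(k,l), x_{i+1}^(k), ..., x_m^(k)),
   where xi k i l is x_i^(k,l); in the last branch j = i. *)
Definition inner_point (x : nat -> X)
    (xi : nat -> forall i : 'I_m, nat -> 'rV[R]_(n i))
    (k : nat) (i : 'I_m) (l : nat) : X :=
  \mxrow_(j < m) (if (j < i)%N then submxrow (x k.+1) j
                  else if (i < j)%N then submxrow (x k) j
                  else xi k j l).

(* An infinite run of the cyclic method, with all the quantities that it
   produces:
   x k is x^(k), z k i is z(k,i), Lk k i is L_i^(k), xi k i l is x_i^(k,l),
   sigma k i l is sigma_i^(k,l), d k i l is d_i^(k,l) and lambda k i l is
   lambda_i^(k,l). As blocks are numbered from 0, z k i (with i <= m a plain
   number) has its first i blocks updated. *)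
Record CBGGP_run
    (Om : forall i, set 'rV[R]_(n i)) (S : forall i, set 'rV[R]_(q i))
    (f : X -> R) (gradf : X -> X)
    (h : forall i, 'rV[R]_(q i) -> 'rV[R]_(n i) -> X -> R)
    (beta delta : R) (L : 'I_m -> nat)
    (x : nat -> X) (z : nat -> nat -> X)
    (Lk : nat -> 'I_m -> nat)
    (xi : nat -> forall i : 'I_m, nat -> 'rV[R]_(n i))
    (sigma : nat -> forall i : 'I_m, nat -> 'rV[R]_(q i))
    (d : nat -> forall i : 'I_m, nat -> 'rV[R]_(n i))
    (lambda : nat -> 'I_m -> nat -> R) : Prop := {
  run_init : block_prod Om (x 0%N) ;
  run_z0 : forall k, z k 0%N = x k ;
  run_xi0 : forall k i, xi k i 0%N = submxrow (x k) i ;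
  run_Lk : forall k i, (1 <= Lk k i <= L i)%N ;
  run_sigma : forall k i l, (l < Lk k i)%N -> S i (sigma k i l) ;
  run_direction : forall k i l, (l < Lk k i)%N ->
    d k i l =
    block_proj Om h (inner_point x xi k i l) (sigma k i l) - xi k i l ;
  run_linesearch : forall k i l, (l < Lk k i)%N ->
    armijo_step f gradf beta delta (inner_point x xi k i l)
                (d k i l) (lambda k i l) ;
  run_update : forall k i l, (l < Lk k i)%N ->
    xi k i l.+1 = xi k i l + lambda k i l *: d k i l ;
  run_block : forall k i, submxrow (x k.+1) i = xi k i (Lk k i) ;
  run_z : forall k (i : 'I_m),
    z k i.+1 = \mxrow_(j < m) (if (j <= i)%N then submxrow (x k.+1) j
                               else submxrow (x k) j) ;
  run_next : forall k, x k.+1 = z k m }.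

End Method.

(* Main.v *)
Require Import Defs.
From mathcomp Require Import all_boot all_order all_algebra.
From mathcomp Require Import all_classical all_reals all_analysis.
From mathcomp Require Import ring lra.
Set Implicit Arguments.
Unset Strict Implicit.
Unset Printing Implicit Defensive.
Import Order.TTheory GRing.Theory Num.Theory.
Import numFieldNormedType.Exports.
Local Open Scope classical_set_scope.
Local Open Scope ring_scope.

(* The values f(x^(k)) decrease to f(xbar), so the decrease of every inner
   Armijo step tends to 0. Along an ultrafilter on the indices that is finer
   than the subsequence converging to xbar, all the bounded sequences converge,
   so that no further subsequence has to be extracted. If an inner point tends
   to xbar, then the generalized projections tend to the projection of xbar (a
   unique minimizer of a convex function depends continuously on the
   parameters), and the vanishing decrease in the Armijo search forces this
   limit to be the i-th block of xbar. Hence the next inner point tends to xbar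
   too, and, going through the blocks, so does every z(k,i); the equality of
   xbar_i with its own projection is stationarity in block i. *)

(** * Limits along filters and ultrafilters *)

Lemma geq_increasing_seq (phi : nat -> nat) k :
  increasing_seq phi -> (k <= phi k)%N.
Proof.
move=> phi_incr; elim: k => // k IH; apply: leq_ltn_trans IH _.
by rewrite ltnNge -leEnat phi_incr -ltnNge.
Qed.

(** Compactness gives a cluster point, and a cluster point of an ultrafilter is a limit: if the
    preimage of a neighbourhood is not in [U], its complement is, which contradicts clustering. *)
Lemma ultra_compact_cvg {T : Type} {U : set_system T} {X : topologicalType}
    (K : set X) (w : T -> X) :
  UltraFilter U -> compact K -> (\forall k \near U, K (w k)) ->
  exists2 p, K p & w k @[k --> U] --> p.
Proof.
move=> UU cK Kw.
have [p [Kp clp]] := cK (w @ U) _ Kw.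
exists p => // N Np; have [//|UnN] := in_ultra_setVsetC (w @^-1` N) UU.
by have [q [nNq Nq]] := clp (~` N) N UnN Np.
Qed.

(** Brings limits along ultrafilters back to the original filter. If the preimage of a neighbourhood
    [N] were not in [F], the trace of [F] on its complement would be proper and would extend to an
    ultrafilter finer than [F] along which [u] avoids [N]. *)
Lemma cvg_ultra {T : Type} {F : set_system T} {FF : Filter F}
    {X : topologicalType} (u : T -> X) (a : X) :
  (forall U, UltraFilter U -> F `<=` U -> u k @[k --> U] --> a) ->
  u k @[k --> F] --> a.
Proof.
move=> ua N Na; apply: contrapT => FnN.
pose G := within [set k | ~ N (u k)] F.
have FG : ProperFilter G.
  apply: Build_ProperFilter => F0; apply: FnN.
  apply: filterS (F0 : F [set k | ~ N (u k) -> False]) => k nk.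
  by apply: contrapT; exact: nk.
have [U [UU GU]] := ultraFilterLemma FG.
have FU : F `<=` U by move=> P FP; apply: GU; apply: filterS FP => k + _.
have UN : U [set k | N (u k)] by exact: ua UU FU N Na.
have UnN : U [set k | ~ N (u k)] by apply: GU; exact: withinT.
by have [k []] := filter_ex (filterI UN UnN).
Qed.

Lemma within_continuous_cvg {T : Type} {F : set_system T} {FF : Filter F}
    {X Y : topologicalType} (A : set X) (g : X -> Y) (u : T -> X) (a : X) :
  {within A, continuous g} -> A a -> (\forall k \near F, A (u k)) ->
  u k @[k --> F] --> a -> g (u k) @[k --> F] --> g a.
Proof.
move=> /subspace_continuousP /(_ a) /[apply] ga FA ua N /ga gN.
have := ua _ gN; rewrite /= nbhs_filterE /fmap/= => FuN.
by apply: filterS2 FA FuN => k Ak; exact.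
Qed.

(* Unlike [ler_cvg_to], the index type carries no topology. *)
Lemma ler_cvg_near {T : Type} {F : set_system T} {FF : ProperFilter F}
    {R : realType} (f g : T -> R) (l l' : R) :
  f k @[k --> F] --> l -> g k @[k --> F] --> l' ->
  (\forall k \near F, f k <= g k) -> l <= l'.
Proof.
move=> fl gl fg; rewrite -subr_ge0; apply: cvgr_to_ge (cvgB gl fl) _.
by apply: filterS fg => k; rewrite subr_ge0.
Qed.

(** * Dot products and convergence of row vectors *)

Section Rows.
Context {R : realType}.

Lemma dotE N (u v : 'rV[R]_N) : dot u v = \sum_i u 0 i * v 0 i.
Proof. by rewrite /dot mxE; apply: eq_bigr => i _; rewrite mxE. Qed.

Lemma dotZr N (u v : 'rV[R]_N) (t : R) : dot u (t *: v) = t * dot u v.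
Proof. by rewrite /dot linearZ/= -scalemxAr mxE. Qed.

Lemma dotBl N (u v w : 'rV[R]_N) : dot (u - v) w = dot u w - dot v w.
Proof. by rewrite /dot mulmxBl !mxE. Qed.

Lemma dot0r N (u : 'rV[R]_N) : dot u 0 = 0.
Proof. by rewrite -(scale0r 0) dotZr mul0r. Qed.

Lemma coord_le_norm N (u : 'rV[R]_N) i : `|u 0 i| <= `|u|.
Proof.
rewrite [leRHS]/Num.norm /= mx_normrE; apply/bigmax_geP; right => /=.
by exists (0, i).
Qed.

(** The norm on row vectors is the maximum norm, hence the factor [N] in place of the constant 1 of
    Cauchy-Schwarz. *)
Lemma norm_dot_le N (u v : 'rV[R]_N) : `|dot u v| <= N%:R * (`|u| * `|v|).
Proof.
rewrite dotE (le_trans (ler_norm_sum _ _ _))//.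
rewrite -[X in X%:R]card_ord mulr_natl -sumr_const.
by apply: ler_sum => i _; rewrite normrM ler_pM ?coord_le_norm.
Qed.

Section Cvg.
Context {T : Type} {F : set_system T} {FF : Filter F}.

Lemma cvg_row N (u : T -> 'rV[R]_N) (a : 'rV[R]_N) :
  (forall i, u k 0 i @[k --> F] --> a 0 i) -> u k @[k --> F] --> a.
Proof.
move=> ua; apply/cvgrPdist_le => e e0.
have : \forall k \near F, forall i, `|a 0 i - u k 0 i| <= e.
  by apply: filter_forall => i; apply: (cvgrPdist_le _ _).1 (ua i) e e0.
apply: filterS => k H.
rewrite [leLHS]/Num.norm /= mx_normrE; apply/bigmax_leP; split=> [|[i j] _ /=].
  exact: ltW.
by have := H j; rewrite !mxE ord1.
Qed.

Lemma cvg_coord N (u : T -> 'rV[R]_N) (a : 'rV[R]_N) i :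
  u k @[k --> F] --> a -> u k 0 i @[k --> F] --> a 0 i.
Proof. by move=> ua; apply: cvg_comp ua (@coord_continuous R 1 N 0 i a). Qed.

Lemma cvg_dot N (u v : T -> 'rV[R]_N) (a b : 'rV[R]_N) :
  u k @[k --> F] --> a -> v k @[k --> F] --> b ->
  dot (u k) (v k) @[k --> F] --> dot a b.
Proof.
move=> ua vb; rewrite dotE; under eq_fun do rewrite dotE.
apply: cvg_big => [|i _]; first exact: add_continuous.
by apply: cvgM; apply: cvg_coord.
Qed.

End Cvg.

Lemma ultra_bounded_cvg {T : Type} {U : set_system T} N (u : T -> 'rV[R]_N) B :
  UltraFilter U -> (\forall k \near U, `|u k| <= B) ->
  exists a : 'rV[R]_N, u k @[k --> U] --> a.
Proof.
move=> UU uB.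
have : compact (closed_ball_ (fun x : 'rV[R]_N => `|x|) 0 B).
  apply: bounded_closed_compact; last exact: closed_closed_ball_.
  exists B; split; first exact: num_real.
  move=> M BM y; rewrite /closed_ball_/= sub0r normrN => /le_trans; apply.
  exact: ltW.
move=> /(ultra_compact_cvg (w := u) UU)[|a _ ua]; last by exists a.
by apply: filterS uB => k; rewrite /closed_ball_/= sub0r normrN.
Qed.

End Rows.

(** * First-order calculus relative to a convex set *)

Section Convex.
Context {R : realType}.

Lemma convex_set_segment N (A : set 'rV[R]_N) (x y : 'rV[R]_N) (t : R) :
  @convex_set R 'rV[R]_N A -> A x -> A y -> 0 <= t <= 1 ->
  A (x + t *: (y - x)).
Proof.
move=> cA Ax Ay /andP[t0 t1].
have := cA y x (Itv01 t0 t1) (mem_set Ay) (mem_set Ax); rewrite inE.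
congr A; rewrite /conv/=.
by rewrite scalerBr scalerBl scale1r addrC addrAC addrA.
Qed.

Lemma convex_function_segment N (A : set 'rV[R]_N) (f : 'rV[R]_N -> R)
    (x y : 'rV[R]_N) (t : R) :
  @convex_function R 'rV[R]_N A f -> A x -> A y -> 0 <= t <= 1 ->
  f (x + t *: (y - x)) <= f x + t * (f y - f x).
Proof.
move=> cf Ax Ay /andP[t0 t1].
have := cf (Itv01 t0 t1) y x (mem_set Ay) (mem_set Ax).
rewrite convRE/= [X in f X](_ : _ = x + t *: (y - x)); last first.
  by rewrite /conv/= scalerBr scalerBl scale1r [RHS]addrCA addrC.
by move=> /le_trans; apply; rewrite /unstable.onem; lra.
Qed.

Lemma C1_on_continuous N (A : set 'rV[R]_N) f g :
  C1_on A f g -> {within A, continuous f}.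
Proof.
move=> [df _]; apply/subspace_continuousP => x Ax.
apply/cvgrPdist_le => e e0.
(* The expansion at [x] with tolerance 1 bounds the increment of [f] by [C] times the distance to
   [x]. *)
pose C := N%:R * `|g x| + 1.
have C0 : 0 < C by rewrite ltr_wpDl// mulr_ge0.
have eC0 : 0 < e / C by rewrite divr_gt0.
have xe : \forall y \near within A (nbhs x), `|x - y| <= e / C.
  have : \forall y \near x, `|x - y| <= e / C; last exact: cvg_within.
  by apply/nbhs_normP; exists (e / C) => // y /=; exact: ltW.
apply: filterS2 xe (df x Ax 1 ltr01) => y xy fy.
have -> : f x - f y = - (f y - f x - dot (g x) (y - x)) - dot (g x) (y - x).
  ring.
rewrite (le_trans (ler_normB _ _))// normrN.
rewrite (le_trans (lerD fy (norm_dot_le _ _)))//.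
rewrite mul1r mulrA -[X in X + _]mul1r -mulrDl addrC -/C mulrC.
by rewrite -ler_pdivlMr// distrC.
Qed.

(** The set may have empty interior, so the one-variable mean value theorem is applied to [f] along
    the segment, which stays in [A] by convexity. *)
Lemma C1_on_mvt N (A : set 'rV[R]_N) f g (a b : 'rV[R]_N) :
  @convex_set R 'rV[R]_N A -> C1_on A f g -> A a -> A b ->
  exists2 c : R, 0 <= c <= 1 &
    f b - f a = dot (g (a + c *: (b - a))) (b - a).
Proof.
move=> cA fg Aa Ab; set v := b - a.
have Aav (s : R) : 0 <= s <= 1 -> A (a + s *: v) by exact: convex_set_segment.
have [|s s01|//|c c01] := @MVT R (fun s => f (a + s *: v))
  (fun s => dot (g (a + s *: v)) v) 0 1.
- exact: ltr01.
- move: s01; rewrite in_itv/= => s01.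
  have Ax : A (a + s *: v) by apply: Aav; lra.
  suff lim : (fun h : R =>
      h^-1 *: (f (a + (h *: (1 : R) + s) *: v) - f (a + s *: v))) @ 0^' -->
      dot (g (a + s *: v)) v.
    apply: DeriveDef; last exact: cvg_lim lim.
    by apply/cvg_ex; exists (dot (g (a + s *: v)) v).
  apply/cvgrPdist_le => e e0.
  pose e' := e / (`|v| + 1).
  have e'0 : 0 < e' by rewrite divr_gt0// ltr_wpDl.
  have yx : (fun h : R => a + (h + s) *: v) @ 0 --> a + s *: v.
    rewrite -[X in _ + X *: v]add0r.
    apply: cvgD; first exact: cvg_cst.
    by apply: cvgZr_tmp; apply: cvgD; [exact: cvg_id|exact: cvg_cst].
  (* As [s] is interior to the unit interval, small increments of both signs stay on the segment, so
     the derivative at [s] is two-sided. *)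
  have h01 : \forall h \near (0 : R), 0 <= h + s <= 1.
    have hs : (fun h : R => h + s) @ 0 --> s.
      rewrite -[X in _ --> X]add0r.
      by apply: cvgD; [exact: cvg_id|exact: cvg_cst].
    have [s0 s1] : 0 < s /\ s < 1 by lra.
    apply: filterS2 (cvgr_ge _ hs _ s0) (cvgr_le _ hs _ s1) => h ? ?.
    exact/andP.
  have fy : \forall h \near (0 : R), A (a + (h + s) *: v) ->
      `|f (a + (h + s) *: v) - f (a + s *: v) -
        dot (g (a + s *: v)) ((a + (h + s) *: v) - (a + s *: v))| <=
      e' * `|(a + (h + s) *: v) - (a + s *: v)|.
    exact: yx _ (fg.1 _ Ax e' e'0).
  have {}fy : \forall h \near 0^',
      `|f (a + (h + s) *: v) - f (a + s *: v) -
        dot (g (a + s *: v)) ((a + (h + s) *: v) - (a + s *: v))| <=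
      e' * `|(a + (h + s) *: v) - (a + s *: v)|.
    by apply: (@nbhs_dnbhs R 0); apply: filterS2 fy h01 => h H /Aav /H.
  apply: filterS2 (nbhs_dnbhs_neq 0) fy => h h0.
  have -> : a + (h + s) *: v - (a + s *: v) = h *: v.
    by rewrite opprD addrACA subrr add0r scalerDl addrK.
  rewrite dotZr normrZ distrC /GRing.scale/= mulr1 => H.
  rewrite -(ler_pM2l (x := `|h|)) ?normr_gt0// -normrM mulrBr mulVKf//.
  rewrite (le_trans H)// mulrCA ler_wpM2l// /e' mulrAC ler_pdivrMr ?ltr_wpDl//.
  by rewrite ler_wpM2l ?(ltW e0)// lerDl.
- apply/subspace_continuousP => s; rewrite /= in_itv/= => s01.
  apply: (within_continuous_cvg (C1_on_continuous fg)).
  + exact: Aav.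
  + apply: filterS (withinT _ _) => t; rewrite /= in_itv/= => t01.
    exact: Aav.
  + apply: cvg_within_filter; apply: cvgD; first exact: cvg_cst.
    by apply: cvgZr_tmp; exact: cvg_id.
- rewrite subr0 mulr1 scale1r scale0r addr0 => fE.
  exists c; last by rewrite -fE [a + v]addrC subrK.
  by move: c01; rewrite in_itv/=; lra.
Qed.

(** Strict differentiability at [x], needed because both ends of the increment move in the
    linesearch. The mean value point lies between [y k] and [v k], hence close to [x], and
    continuity of [g] lets [g x] replace the gradient there. *)
Lemma C1_on_strict_le {T : Type} {F : set_system T} {FF : Filter F} N
    (A : set 'rV[R]_N) f g (x : 'rV[R]_N) (y v : T -> 'rV[R]_N) (e : R) :
  @convex_set R 'rV[R]_N A -> C1_on A f g -> A x -> 0 < e ->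
  (\forall k \near F, A (y k)) -> (\forall k \near F, A (v k)) ->
  y k @[k --> F] --> x -> v k @[k --> F] --> x ->
  \forall k \near F,
    f (v k) - f (y k) <= dot (g x) (v k - y k) + e * `|v k - y k|.
Proof.
move=> cA fg Ax e0 Ay Av yx vx.
pose e' := e / (N%:R + 1).
have e'0 : 0 < e' by rewrite divr_gt0// ltr_wpDl.
have /subspace_continuousP/(_ x Ax)/cvgrPdist_le/(_ _ e'0) := fg.2.
move=> /nbhs_ballP[r /= r0 gr].
have yr : \forall k \near F, `|x - y k| < r by exact: cvgr_dist_lt yx _ r0.
have vr : \forall k \near F, `|x - v k| < r by exact: cvgr_dist_lt vx _ r0.
near=> k.
have Ayk : A (y k) by near: k.
have Avk : A (v k) by near: k.
have yrk : `|x - y k| < r by near: k.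
have vrk : `|x - v k| < r by near: k.
have [c c01 ->] := C1_on_mvt cA fg Ayk Avk.
set w := y k + _; have Aw : A w by exact: convex_set_segment.
have xw : `|x - w| < r.
  have -> : x - w = (1 - c) *: (x - y k) + c *: (x - v k).
    rewrite /w scalerBl scale1r -addrA -scalerN -scalerDr opprB addrA.
    by rewrite subrK opprD -scalerN opprB addrA.
  rewrite (le_lt_trans (ler_normD _ _))// !normrZ.
  rewrite !ger0_norm; [|lra|lra].
  (* A strict bound needs a term of nonzero weight: the first one if [c] is 0, the second one
     otherwise. *)
  have [c0|c0] := eqVneq c 0; first by rewrite c0 mul0r subr0 mul1r addr0.
  have : c * `|x - v k| < c * r by rewrite ltr_pM2l// lt_neqAle eq_sym c0; lra.
  have : (1 - c) * `|x - y k| <= (1 - c) * r by rewrite ler_wpM2l//; lra.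
  by lra.
have gw : `|g x - g w| <= e' by apply: gr => //; rewrite -ball_normE.
have -> : dot (g w) (v k - y k) =
    dot (g x) (v k - y k) - dot (g x - g w) (v k - y k).
  by rewrite dotBl; ring.
rewrite lerD2l.
have := norm_dot_le (g x - g w) (v k - y k).
have := ler_norm (- dot (g x - g w) (v k - y k)); rewrite normrN.
have : N%:R * (`|g x - g w| * `|v k - y k|) <= e * `|v k - y k|.
  rewrite mulrA ler_wpM2r// (le_trans (ler_wpM2l _ gw))//.
  rewrite /e' mulrCA ler_piMr ?(ltW e0)// ler_pdivrMr ?ltr_wpDl// mul1r.
  by rewrite lerDl.
by lra.
Unshelve. all: by end_near. Qed.

(** One-sided, since [x] may lie on the boundary of [A] and only forward steps are known to stay in
    it. *)
Lemma C1_on_right_derivative N (A : set 'rV[R]_N) f g (x v : 'rV[R]_N) (e : R) :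
  C1_on A f g -> A x -> (forall t, 0 <= t <= 1 -> A (x + t *: v)) -> 0 < e ->
  \forall t \near (0 : R)^'+,
    `|f (x + t *: v) - f x - dot (g x) v * t| <= e * t.
Proof.
move=> [df _] Ax Av e0.
pose e' := e / (`|v| + 1).
have e'0 : 0 < e' by rewrite divr_gt0// ltr_wpDl.
have yx : (fun t : R => x + t *: v) @ 0^'+ --> x.
  rewrite -[X in _ --> X]addr0 -[X in _ + X](scale0r v).
  apply: cvgD; first exact: cvg_cst.
  by apply: cvgZr_tmp; apply: cvg_within_filter; exact: cvg_id.
have fy : \forall t \near (0 : R)^'+, A (x + t *: v) ->
    `|f (x + t *: v) - f x - dot (g x) (x + t *: v - x)| <=
    e' * `|x + t *: v - x|.
  exact: yx _ (df x Ax e' e'0).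
near=> t.
have t0 : 0 < t by near: t; exact: nbhs_right_gt.
have t1 : t <= 1 by near: t; exact: nbhs_right_le.
have : A (x + t *: v) by apply: Av; rewrite ltW.
have /[apply] : A (x + t *: v) ->
    `|f (x + t *: v) - f x - dot (g x) (x + t *: v - x)| <=
    e' * `|x + t *: v - x| by near: t.
rewrite [x + _ - x]addrAC subrr add0r dotZr normrZ gtr0_norm// mulrC.
move=> /le_trans; apply; rewrite mulrCA [leRHS]mulrC ler_pM2l// /e' mulrAC.
by rewrite ler_pdivrMr ?ltr_wpDl// ler_wpM2l ?(ltW e0)// lerDl.
Unshelve. all: by end_near. Qed.

(** By convexity the difference quotients on the segment are at most [f y - f x], and they tend to
    [l]. Asking only for a right derivative makes this applicable to a partial function of a
    differentiable function of pairs. *)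
Lemma C1_convex_grad_le N (A : set 'rV[R]_N) (f : 'rV[R]_N -> R) (l : R)
    (x y : 'rV[R]_N) :
  @convex_function R 'rV[R]_N A f -> A x -> A y ->
  (forall e, 0 < e -> \forall t \near (0 : R)^'+,
     `|f (x + t *: (y - x)) - f x - l * t| <= e * t) ->
  l <= f y - f x.
Proof.
move=> cf Ax Ay lf; apply/ler_addgt0Pr => e e0.
have t1 : \forall t \near (0 : R)^'+, t <= 1 by exact: nbhs_right_le.
have [t [[/ler_normlP[tl _] t0] t1']] := filter_ex (filterI (filterI (lf e e0)
  (nbhs_right_gt 0)) t1).
have := convex_function_segment (t := t) cf Ax Ay.
rewrite t1' ltW// => /(_ erefl) H.
rewrite -(ler_pM2r t0).
by lra.
Qed.

End Convex.

(** * Continuous dependence of a unique minimizer of convex functions *)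

Section Argmin.
Context {R : realType} {T : Type} {U : set_system T} {UU : UltraFilter U}.

(** Convexity replaces any bound on the minimizers [u k]. If they stay at distance at least [r] from
    [v], the points [w k] of the segments from [v] to [u k] at distance exactly [r] satisfy
    [H k (w k) <= H k v]. Being bounded, they converge along [U] to a second minimizer of [H'] at
    distance [r] from [v], against uniqueness. *)
Lemma argmin_cvg N (A : set 'rV[R]_N) (H : T -> 'rV[R]_N -> R)
    (H' : 'rV[R]_N -> R) (u : T -> 'rV[R]_N) (v : 'rV[R]_N) :
  closed A -> @convex_set R 'rV[R]_N A ->
  (\forall k \near U, @convex_function R 'rV[R]_N A (H k)) ->
  (forall w a, (\forall k \near U, A (w k)) -> A a -> w k @[k --> U] --> a ->
    H k (w k) @[k --> U] --> H' a) ->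
  (\forall k \near U, min_points A (H k) (u k)) ->
  min_points A H' v -> (forall v', min_points A H' v' -> v' = v) ->
  u k @[k --> U] --> v.
Proof.
move=> Acl Acv Hcv Hcvg Umin [Av vmin] vuniq.
apply/cvgrPdist_lt => r r0.
have [//|far] := in_ultra_setVsetC [set k | `|v - u k| < r] UU.
exfalso.
pose w k := v + (r / `|u k - v|) *: (u k - v).
have wP : \forall k \near U, [/\ A (w k), `|w k - v| = r & H k (w k) <= H k v].
  near=> k.
  have kfar : r <= `|u k - v|.
    by rewrite distrC leNgt; apply/negP; near: k; exact: far.
  have [Auk ukmin] : min_points A (H k) (u k) by near: k.
  have Hk : @convex_function R 'rV[R]_N A (H k) by near: k.
  have uv0 : 0 < `|u k - v| by exact: lt_le_trans kfar.
  have t01 : 0 <= r / `|u k - v| <= 1.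
    by rewrite divr_ge0 ?(ltW r0)//= ler_pdivrMr// mul1r.
  split; first exact: convex_set_segment.
    rewrite /w addrAC subrr add0r normrZ ger0_norm; last by case/andP: t01.
    by rewrite divfK// gt_eqF.
  rewrite (le_trans (convex_function_segment Hk Av Auk t01))// gerDl.
  by rewrite mulr_ge0_le0 ?subr_le0 ?ukmin//; case/andP: t01.
have [a wa] : exists a : 'rV[R]_N, w k @[k --> U] --> a.
  apply: (@ultra_bounded_cvg _ _ _ _ _ (`|v| + r)).
  apply: filterS wP => k [_ wr _].
  by rewrite -(subrK v (w k)) addrC (le_trans (ler_normD _ _))// wr.
have Aw : \forall k \near U, A (w k) by apply: filterS wP => k [].
have Aa : A a by exact: closed_cvg Acl Aw _ wa.
have av : `|a - v| = r.
  have : `|w k - v| @[k --> U] --> `|a - v|.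
    by apply: cvg_norm; apply: cvgB => //; exact: cvg_cst.
  have : `|w k - v| @[k --> U] --> r.
    by apply: cvg_near_cst; apply: filterS wP => k [].
  by move=> /[swap]; exact: cvg_unique.
have : a = v.
  apply: vuniq; split=> // y Ay; apply: le_trans (vmin y Ay).
  have Hv : H k v @[k --> U] --> H' v.
    by apply: (Hcvg (fun=> v)) => //; [exact: nearW|exact: cvg_cst].
  apply: ler_cvg_near (Hcvg w a Aw Aa wa) Hv _.
  by apply: filterS wP => k [].
by move=> aE; move: av r0; rewrite aE subrr normr0 => <-; rewrite ltxx.
Unshelve. all: by end_near. Qed.

End Argmin.

(** * Blocks of vectors and factors of a product set *)

Section BlockTheory.
Context {R : realType} {m : nat} {n : 'I_m -> nat}.
Notation X := 'rV[R]_(\sum_i n i).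

Lemma submxrow_block_inj (i : 'I_m) (d : 'rV[R]_(n i)) :
  submxrow (block_inj d) i = d.
Proof. by rewrite /block_inj mxrowK dfwithin. Qed.

Lemma submxrow_block_inj_neq (i j : 'I_m) (d : 'rV[R]_(n i)) :
  i != j -> submxrow (block_inj d) j = 0.
Proof. by move=> ij; rewrite /block_inj mxrowK dfwithout. Qed.

Lemma submxrowZ (t : R) (x : X) (i : 'I_m) :
  submxrow (t *: x) i = t *: submxrow x i.
Proof. by apply/rowP => j; rewrite !mxE. Qed.

Lemma block_injZ (t : R) (i : 'I_m) (d : 'rV[R]_(n i)) :
  block_inj (t *: d) = t *: block_inj d.
Proof.
apply/mxrowP => j; rewrite submxrowZ; have [<-|ij] := eqVneq i j.
  by rewrite !submxrow_block_inj.
by rewrite !submxrow_block_inj_neq// scaler0.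
Qed.

Lemma block_inj0 (i : 'I_m) : block_inj (0 : 'rV[R]_(n i)) = 0.
Proof. by rewrite -(scale0r 0) block_injZ scale0r. Qed.

Lemma dot_blocks (u v : X) :
  dot u v = \sum_i dot (submxrow u i) (submxrow v i).
Proof.
rewrite /dot -[in LHS](submxrowK u) -[in LHS](submxrowK v) tr_mxrow.
by rewrite mul_mxrow_mxcol summxE.
Qed.

Lemma dot_block_inj (u : X) (i : 'I_m) (d : 'rV[R]_(n i)) :
  dot u (block_inj d) = dot (submxrow u i) d.
Proof.
rewrite dot_blocks (bigD1 i)//= submxrow_block_inj big1 ?addr0// => j ji.
by rewrite submxrow_block_inj_neq 1?eq_sym// dot0r.
Qed.

Section Cvg.
Context {T : Type} {F : set_system T} {FF : Filter F}.

Lemma cvg_submxrow (u : T -> X) (a : X) (i : 'I_m) :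
  u k @[k --> F] --> a -> submxrow (u k) i @[k --> F] --> submxrow a i.
Proof.
move=> ua; apply: cvg_row => j; rewrite mxE; under eq_fun do rewrite mxE.
exact: cvg_coord.
Qed.

Lemma cvg_mxrow (u : T -> X) (a : X) :
  (forall i, submxrow (u k) i @[k --> F] --> submxrow a i) ->
  u k @[k --> F] --> a.
Proof.
move=> ua; apply: cvg_row => j.
rewrite -[a]submxrowK mxE; under eq_fun do rewrite -[u _]submxrowK mxE.
exact: cvg_coord (ua _).
Qed.

Lemma cvg_block_inj (i : 'I_m) (d : T -> 'rV[R]_(n i)) (a : 'rV[R]_(n i)) :
  d k @[k --> F] --> a -> block_inj (d k) @[k --> F] --> block_inj a.
Proof.
move=> da; apply: cvg_mxrow => j; have [<-|ij] := eqVneq i j.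
  by rewrite submxrow_block_inj; under eq_fun do rewrite submxrow_block_inj.
rewrite submxrow_block_inj_neq//.
by under eq_fun do rewrite submxrow_block_inj_neq//; exact: cvg_cst.
Qed.

End Cvg.

(** Written as a displacement of [x], so that moving from [x] towards it is a step along [block_inj]
    of a direction, as in the method. *)
Definition set_block (x : X) (i : 'I_m) (u : 'rV[R]_(n i)) : X :=
  x + block_inj (u - submxrow x i).

Lemma submxrow_set_block (x : X) (i : 'I_m) (u : 'rV[R]_(n i)) :
  submxrow (set_block x u) i = u.
Proof. by rewrite /set_block submxrowD submxrow_block_inj addrC subrK. Qed.

Lemma submxrow_set_block_neq (x : X) (i j : 'I_m) (u : 'rV[R]_(n i)) :
  i != j -> submxrow (set_block x u) j = submxrow x j.
Proof.
by move=> ij; rewrite /set_block submxrowD submxrow_block_inj_neq// addr0.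
Qed.

Lemma cvg_set_block {T : Type} {F : set_system T} {FF : Filter F} (x : X)
    (i : 'I_m) (u : T -> 'rV[R]_(n i)) (a : 'rV[R]_(n i)) :
  u k @[k --> F] --> a -> set_block x (u k) @[k --> F] --> set_block x a.
Proof.
move=> ua; rewrite /set_block; apply: cvgD; first exact: cvg_cst.
by apply: cvg_block_inj; apply: cvgB => //; exact: cvg_cst.
Qed.

Lemma block_prod_set_block (Om : forall i, set 'rV[R]_(n i)) (x : X)
    (i : 'I_m) (u : 'rV[R]_(n i)) :
  block_prod Om x -> block_prod Om (set_block x u) <-> Om i u.
Proof.
move=> Omx; split=> [/(_ i)|Omu j]; first by rewrite submxrow_set_block.
have [ij|ij] := eqVneq i j; last by rewrite submxrow_set_block_neq.
by move: u Omu; rewrite ij => u; rewrite submxrow_set_block.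
Qed.

(** A point of the product is required because an empty product says nothing about its other
    factors. With such a point, the factor is the preimage of the product under the continuous map
    that replaces block [i]. *)
Lemma factor_closed (Om : forall i, set 'rV[R]_(n i)) (x : X) (i : 'I_m) :
  block_prod Om x -> closed (block_prod Om) -> closed (Om i).
Proof.
move=> Omx Omcl.
rewrite (_ : Om i = (fun u => set_block x u) @^-1` block_prod Om).
  apply: closed_comp => [u _|//].
  by apply: (cvg_set_block (F := nbhs u)); exact: cvg_id.
by apply/seteqP; split=> u /(block_prod_set_block _ Omx).
Qed.

Lemma factor_convex (Om : forall i, set 'rV[R]_(n i)) (x : X) (i : 'I_m) :
  block_prod Om x ->
  @convex_set R X (block_prod Om) -> @convex_set R 'rV[R]_(n i) (Om i).
Proof.
move=> Omx cOm u v t; rewrite !inE => /(block_prod_set_block _ Omx) Omu.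
move=> /(block_prod_set_block _ Omx) Omv.
have := cOm _ _ t (mem_set Omu) (mem_set Omv); rewrite inE => /(_ i).
rewrite /conv/=.
by rewrite submxrowD !submxrowZ !submxrow_set_block.
Qed.

Lemma factor_compact (Om : forall i, set 'rV[R]_(n i)) (x : X) (i : 'I_m) :
  block_prod Om x -> compact (block_prod Om) -> compact (Om i).
Proof.
move=> Omx Omc.
rewrite (_ : Om i = (fun y : X => submxrow y i) @` block_prod Om).
  apply: continuous_compact Omc; apply: continuous_subspaceT => y.
  by apply: (cvg_submxrow (F := nbhs y)); exact: cvg_id.
apply/seteqP; split=> [u Omu|_ [y Omy <-]]; last exact: Omy.
exists (set_block x u); first exact/(block_prod_set_block _ Omx).
exact: submxrow_set_block.
Qed.

End BlockTheory.

(** * Generalized projections: descent, stationarity and continuity *)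

Section Method.
Context {R : realType} {m : nat} {n q : 'I_m -> nat}.
Notation X := 'rV[R]_(\sum_i n i).
Context {Om : forall i, set 'rV[R]_(n i)} {S : forall i, set 'rV[R]_(q i)}
  {f : X -> R} {gradf : X -> X} {hs : 'rV[R]_(\sum_i q i) -> X -> X -> R}
  {h : forall i, 'rV[R]_(q i) -> 'rV[R]_(n i) -> X -> R}
  {gradh : forall i, 'rV[R]_(q i) ->
     'rV[R]_(n i + \sum_j n j) -> 'rV[R]_(n i + \sum_j n j)}
  (h_metric : block_separable_metric Om S gradf hs h gradh).
Arguments Om : clear implicits.
Arguments S : clear implicits.
Arguments h : clear implicits.
Arguments gradh : clear implicits.

(** In the space of pairs the direction is [row_mx d 0], so only the first part of [gradh]
    contributes, and [bsm_grad] identifies its slope with that of block [i] of [gradf]. *)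
Lemma metric_right_derivative (i : 'I_m) (s : 'rV[R]_(q i)) (y : X)
    (u : 'rV[R]_(n i)) (e : R) :
  S i s -> block_prod Om y -> @convex_set R 'rV[R]_(n i) (Om i) -> Om i u ->
  0 < e ->
  let d := u - submxrow y i in
  \forall t \near (0 : R)^'+,
    `|h i s (submxrow y i + t *: d) y - h i s (submxrow y i) y -
      dot (submxrow (gradf y) i) d * t| <= e * t.
Proof.
move=> Ss Omy cOm Omu e0 d.
have segE t : row_mx (submxrow y i) y + t *: row_mx d 0 =
    row_mx (submxrow y i + t *: d) y.
  by rewrite scale_row_mx add_row_mx scaler0 addr0.
have Omseg t : 0 <= t <= 1 ->
    Om i (lsubmx (row_mx (submxrow y i) y + t *: row_mx d 0)) /\
    block_prod Om (rsubmx (row_mx (submxrow y i) y + t *: row_mx d 0)).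
  move=> t01; rewrite segE row_mxKl row_mxKr; split=> //.
  by apply: convex_set_segment => //; exact: Omy.
rewrite -(bsm_grad h_metric Ss Omy); last by rewrite /d addrC subrK.
have := C1_on_right_derivative (x := row_mx (submxrow y i) y)
  (v := row_mx d 0) (bsm_C1 h_metric Ss) _ Omseg e0.
rewrite /= row_mxKl row_mxKr => /(_ (conj (Omy i) Omy)).
apply: filterS => t; rewrite segE row_mxKl row_mxKr.
rewrite -[X in dot X (row_mx _ _)]hsubmxK.
by rewrite {1}/dot tr_row_mx mul_row_col trmx0 mulmx0 addr0.
Qed.

Lemma metric_grad_le (i : 'I_m) (s : 'rV[R]_(q i)) (y : X) (u : 'rV[R]_(n i)) :
  S i s -> block_prod Om y -> @convex_set R 'rV[R]_(n i) (Om i) -> Om i u ->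
  dot (submxrow (gradf y) i) (u - submxrow y i) <=
  h i s u y - h i s (submxrow y i) y.
Proof.
move=> Ss Omy cOm Omu.
apply: (C1_convex_grad_le (bsm_convex h_metric Ss Omy)) => // e e0.
exact: metric_right_derivative.
Qed.

Lemma block_proj_min (i : 'I_m) (s : 'rV[R]_(q i)) (y : X) :
  S i s -> block_prod Om y ->
  min_points (Om i) (fun u => h i s u y) (block_proj Om h y s) /\
  forall v, min_points (Om i) (fun u => h i s u y) v -> v = block_proj Om h y s.
Proof.
move=> Ss Omy; have [u [umin uuniq]] := bsm_unique_min h_metric Ss Omy.
have pmin : min_points (Om i) (fun u => h i s u y) (block_proj Om h y s).
  by apply: getPex; exists u.
by split=> // v /uuniq <-; exact: uuniq.
Qed.

(** The slope is at most the change of the metric function from block [i] of [y] to its minimizer,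
    which is nonpositive. A zero slope makes that block a minimizer too, so uniqueness gives
    [d = 0]. *)
Lemma direction_descent (i : 'I_m) (s : 'rV[R]_(q i)) (y : X) :
  S i s -> block_prod Om y -> @convex_set R 'rV[R]_(n i) (Om i) ->
  let d := block_proj Om h y s - submxrow y i in
  dot (submxrow (gradf y) i) d <= 0 ?= iff (d == 0).
Proof.
move=> Ss Omy cOm d; have [[Omp pmin] puniq] := block_proj_min Ss Omy.
have le_d := metric_grad_le Ss Omy cOm Omp.
have le_h := pmin _ (Omy i).
split; first by rewrite (le_trans le_d)// subr_le0.
have [->|d0] := eqVneq d 0; first by rewrite dot0r eqxx.
apply/negP => /eqP dE; move/negP: d0; apply.
rewrite subr_eq0; apply/eqP/esym/puniq; split=> [|v Omv]; first exact: Omy.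
rewrite (le_trans _ (pmin v Omv))// -subr_ge0.
by move: le_d; rewrite -/d dE.
Qed.

(** A fixed point of the projection minimizes the metric function, whose right derivatives along
    feasible directions are then nonnegative; these are the slopes given by [gradf]. *)
Lemma block_proj_stationary (i : 'I_m) (s : 'rV[R]_(q i)) (y : X)
    (u : 'rV[R]_(n i)) :
  S i s -> block_prod Om y -> @convex_set R 'rV[R]_(n i) (Om i) ->
  block_proj Om h y s = submxrow y i -> Om i u ->
  0 <= dot (submxrow (gradf y) i) (u - submxrow y i).
Proof.
move=> Ss Omy cOm py Omu; have [[_ ymin] _] := block_proj_min Ss Omy.
rewrite py in ymin; apply/ler_addgt0Pr => e e0.
have [t [[/ler_normlP[_ td] t0] t1]] := filter_ex (filterI (filterI
  (metric_right_derivative Ss Omy cOm Omu e0) (nbhs_right_gt 0))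
  (nbhs_right_le (ltr01 : 0 < 1 :> R))).
have t01 : 0 <= t <= 1 by rewrite t1 ltW.
have := ymin _ (convex_set_segment cOm (Omy i) Omu t01).
by rewrite -(pmulr_lge0 _ t0); lra.
Qed.

Context (Om_closed : closed (block_prod Om))
  (Om_convex : @convex_set R X (block_prod Om))
  (f_C1 : C1_on (block_prod Om) f gradf).

Lemma block_proj_cvg {T : Type} {U : set_system T} {UU : UltraFilter U}
    (i : 'I_m) (s : T -> 'rV[R]_(q i)) (sbar : 'rV[R]_(q i))
    (y : T -> X) (ybar : X) :
  (\forall k \near U, S i (s k)) -> S i sbar ->
  (\forall k \near U, block_prod Om (y k)) -> block_prod Om ybar ->
  s k @[k --> U] --> sbar -> y k @[k --> U] --> ybar ->
  block_proj Om h (y k) (s k) @[k --> U] --> block_proj Om h ybar sbar.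
Proof.
move=> Ss Ssbar Omy Omybar s_cvg y_cvg.
have [pmin puniq] := block_proj_min Ssbar Omybar.
apply: (argmin_cvg (A := Om i) (H := fun k u => h i (s k) u (y k))
  (H' := fun u => h i sbar u ybar)) pmin puniq.
- exact: factor_closed Omybar Om_closed.
- exact: factor_convex Omybar Om_convex.
- apply: filterS2 Ss Omy => k Ssk Omyk.
  exact: (bsm_convex h_metric Ssk Omyk).
- move=> w a Omw Oma wa.
  apply: (within_continuous_cvg (u := fun k => (s k, (w k, y k)))
    (a := (sbar, (a, ybar))) (bsm_continuous h_metric (i := i))) => //=.
    by apply: filterS3 Ss Omw Omy => k.
  apply: (cvg_pair (G := nbhs sbar) (H := nbhs (a, ybar))) => //.
  exact: (cvg_pair (G := nbhs a) (H := nbhs ybar)).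
- by apply: filterS2 Ss Omy => k Ssk Omyk; have [] := block_proj_min Ssk Omyk.
Qed.

(** * Armijo steps with vanishing decrease *)

Context {beta delta : R} (beta01 : 0 < beta < 1) (delta01 : 0 < delta < 1).

Lemma armijo_step_le (i : 'I_m) (y : X) (d : 'rV[R]_(n i)) (l : R) :
  armijo_step f gradf beta delta y d l ->
  [/\ 0 < l, l <= 1 & armijo f gradf beta y d l].
Proof.
have /andP[d0 d1] := delta01.
by move=> [j [-> aj _]]; rewrite exprn_gt0// exprn_ile1// ltW.
Qed.

(** A step below 1 is not the first trial, so [l / delta] is the trial just before it, which was
    rejected. *)
Lemma armijo_step_lt1 (i : 'I_m) (y : X) (d : 'rV[R]_(n i)) (l : R) :
  armijo_step f gradf beta delta y d l -> l < 1 ->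
  l / delta <= 1 /\ ~ armijo f gradf beta y d (l / delta).
Proof.
have /andP[d0 d1] := delta01.
move=> [[|j] [-> aj minj]]; first by rewrite expr0 ltxx.
move=> _; rewrite exprS mulrC mulKf ?gt_eqF// exprn_ile1// ?ltW//.
by split=> //; exact: minj.
Qed.

(* If the limit direction [dbar] were nonzero, it would be a strict descent
   direction; the vanishing decrease then forces the steps to 0, hence the
   previous trial steps [l / delta] violate the Armijo condition, and the mean
   value theorem gives [beta * dot g dbar <= dot g dbar], a contradiction. *)
Lemma armijo_direction_limit {T : Type} {U : set_system T} {UU : UltraFilter U}
    (i : 'I_m) (s : T -> 'rV[R]_(q i)) (sbar : 'rV[R]_(q i))
    (y : T -> X) (ybar : X) (l : T -> R) :
  let d k := block_proj Om h (y k) (s k) - submxrow (y k) i in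
  (\forall k \near U, S i (s k)) -> S i sbar ->
  (\forall k \near U, block_prod Om (y k)) -> block_prod Om ybar ->
  s k @[k --> U] --> sbar -> y k @[k --> U] --> ybar ->
  (\forall k \near U, armijo_step f gradf beta delta (y k) (d k) (l k)) ->
  f (y k) - f (y k + l k *: block_inj (d k)) @[k --> U] --> (0 : R) ->
  block_proj Om h ybar sbar = submxrow ybar i.
Proof.
move=> d Ss Ssbar Omy Omybar s_cvg y_cvg steps dec0.
have cOm : @convex_set R 'rV[R]_(n i) (Om i) := factor_convex Omybar Om_convex.
have p_cvg := block_proj_cvg (UU := UU) Ss Ssbar Omy Omybar s_cvg y_cvg.
set dbar := block_proj Om h ybar sbar - submxrow ybar i.
have d_cvg : d k @[k --> U] --> dbar.
  by apply: cvgB => //; exact: cvg_submxrow.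
apply/eqP; rewrite -subr_eq0 -/dbar; apply/negPn/negP => dbar0.
set c := dot (submxrow (gradf ybar) i) dbar.
have c0 : c < 0.
  have [+ E] := direction_descent Ssbar Omybar cOm.
  by rewrite -/dbar -/c le_eqVlt -/c E -/dbar (negbTE dbar0).
have gd_cvg : dot (submxrow (gradf (y k)) i) (d k) @[k --> U] --> c.
  apply: cvg_dot d_cvg; apply: cvg_submxrow.
  exact: within_continuous_cvg f_C1.2 Omybar Omy y_cvg.
have /andP[b0 b1] := beta01; have /andP[de0 de1] := delta01.
have gd_lt : \forall k \near U, dot (submxrow (gradf (y k)) i) (d k) <= c / 2.
  by apply: cvgr_le gd_cvg _ _; lra.
have K0 : 0 < beta * (- c / 2) by rewrite mulr_gt0//; lra.
(* With slopes eventually at most [c / 2], the Armijo condition makes the decrease at least [l k]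
   times the positive constant [beta * (- c / 2)]. *)
have l_cvg : l k @[k --> U] --> (0 : R).
  apply: (squeeze_cvgr (f := fun=> 0)
    (h := fun k => (f (y k) - f (y k + l k *: block_inj (d k))) /
      (beta * (- c / 2)))).
  - apply: filterS2 gd_lt steps => k gdk /armijo_step_le[l0 _ ak].
    rewrite ltW//= ler_pdivlMr//.
    have : (beta * l k) * dot (submxrow (gradf (y k)) i) (d k) <=
           (beta * l k) * (c / 2) by rewrite ler_wpM2l// mulr_ge0// ltW.
    by move: ak; rewrite /armijo; lra.
  - exact: cvg_cst.
  - by rewrite -(mul0r (beta * (- c / 2))^-1); apply: cvgMr_tmp.
have t_cvg : l k / delta @[k --> U] --> (0 : R).
  by rewrite -(mul0r delta^-1); apply: cvgMr_tmp.
pose v k := y k + (l k / delta) *: block_inj (d k).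
have D_cvg : block_inj (d k) @[k --> U] --> block_inj dbar.
  exact: cvg_block_inj.
have v_cvg : v k @[k --> U] --> ybar.
  rewrite -[X in _ --> X]addr0 -(scale0r (block_inj dbar)).
  by apply: cvgD => //; exact: cvgZ.
have l1 : \forall k \near U, l k < 1 by apply: cvgr_lt l_cvg _ _.
have Omv : \forall k \near U, block_prod Om (v k).
  near=> k.
  have Omyk : block_prod Om (y k) by near: k.
  have Ssk : S i (s k) by near: k.
  have lk1 : l k < 1 by near: k.
  have ak : armijo_step f gradf beta delta (y k) (d k) (l k) by near: k.
  have [lk0 _ _] := armijo_step_le ak.
  have [t1 _] := armijo_step_lt1 ak lk1.
  have [[Omp _] _] := block_proj_min Ssk Omyk.
  have := convex_set_segment (t := l k / delta) Om_convex Omyk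
    ((block_prod_set_block _ Omyk).2 Omp).
  rewrite /set_block addrAC subrr add0r; apply.
  by rewrite t1 divr_ge0// ltW.
pose D := `|block_inj dbar|.
(* Chosen so that [c + e * D < beta * c], contrary to the limit of the rejected Armijo inequalities;
   the added 1 makes this strict. *)
pose e := (1 - beta) * (- c) / (D + 1).
have D0 : 0 < D + 1 by rewrite ltr_wpDl// normr_ge0.
have e0 : 0 < e by rewrite divr_gt0// mulr_gt0//; lra.
have vy : \forall k \near U, f (v k) - f (y k) <=
    dot (gradf ybar) (v k - y k) + e * `|v k - y k|.
  exact: C1_on_strict_le Om_convex f_C1 Omybar e0 Omy Omv y_cvg v_cvg.
have : beta * c <= c + e * D.
  have lhs_cvg : beta * dot (submxrow (gradf (y k)) i) (d k)
      @[k --> U] --> beta * c.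
    by apply: cvgMl_tmp.
  have rhs_cvg : dot (submxrow (gradf ybar) i) (d k) + e * `|block_inj (d k)|
      @[k --> U] --> c + e * D.
    apply: cvgD; first by apply: cvg_dot => //; exact: cvg_cst.
    by apply: cvgMl_tmp; exact: cvg_norm.
  apply: ler_cvg_near lhs_cvg rhs_cvg _.
  near=> k.
  have lk1 : l k < 1 by near: k.
  have ak : armijo_step f gradf beta delta (y k) (d k) (l k) by near: k.
  have [lk0 _ _] := armijo_step_le ak.
  have [_ /negP] := armijo_step_lt1 ak lk1.
  rewrite -ltNge => Nak.
  have t0 : 0 < l k / delta by rewrite divr_gt0.
  have : f (v k) - f (y k) <=
      dot (gradf ybar) (v k - y k) + e * `|v k - y k| by near: k.
  have -> : v k - y k = (l k / delta) *: block_inj (d k).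
    by rewrite /v addrAC subrr add0r.
  rewrite /v dotZr dot_block_inj normrZ gtr0_norm// => vk_le.
  rewrite -(ler_pM2l t0).
  by lra.
have : e * D < (1 - beta) * (- c).
  by rewrite /e mulrAC ltr_pdivrMr// ltr_pM2l ?ltrDl// mulr_gt0//; lra.
by lra.
Unshelve. all: by end_near. Qed.

(** Compactness of [S i] provides the limit parameter [sbar]. The limit direction is then 0, and as
    the steps are at most 1 the updated points keep the same limit. *)
Lemma armijo_update_cvg {T : Type} {U : set_system T} {UU : UltraFilter U}
    (i : 'I_m) (s : T -> 'rV[R]_(q i)) (y : T -> X) (ybar : X) (l : T -> R) :
  let d k := block_proj Om h (y k) (s k) - submxrow (y k) i in
  compact (S i) -> (\forall k \near U, S i (s k)) ->
  (\forall k \near U, block_prod Om (y k)) -> y k @[k --> U] --> ybar ->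
  (\forall k \near U, armijo_step f gradf beta delta (y k) (d k) (l k)) ->
  f (y k) - f (y k + l k *: block_inj (d k)) @[k --> U] --> (0 : R) ->
  y k + l k *: block_inj (d k) @[k --> U] --> ybar /\
  exists2 sbar, S i sbar & block_proj Om h ybar sbar = submxrow ybar i.
Proof.
move=> d cS Ss Omy y_cvg steps dec0.
have [sbar Ssbar s_cvg] := ultra_compact_cvg UU cS Ss.
have Omybar : block_prod Om ybar by exact: closed_cvg Om_closed Omy _ y_cvg.
have pE := armijo_direction_limit (UU := UU) Ss Ssbar Omy Omybar s_cvg y_cvg
  steps dec0.
split; last by exists sbar.
have d_cvg : d k @[k --> U] --> (0 : 'rV[R]_(n i)).
  rewrite -[X in _ --> X](subrr (submxrow ybar i)) -{1}pE.
  apply: cvgB; last exact: cvg_submxrow.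
  exact: (block_proj_cvg (UU := UU)).
rewrite -[X in _ --> X]addr0; apply: cvgD => //.
have : block_inj (d k) @[k --> U] --> (0 : X).
  by rewrite -(block_inj0 i); exact: cvg_block_inj.
move=> /cvgrPdist_le D_cvg; apply/cvgrPdist_le => e e0.
apply: filterS2 steps (D_cvg e e0) => k /armijo_step_le[l0 l1 _].
rewrite !sub0r !normrN normrZ gtr0_norm// => /(le_trans _); apply.
by rewrite ler_piMl.
Qed.

(** * Feasibility and monotonicity along a run *)

Context {L : 'I_m -> nat} {x : nat -> X} {z : nat -> nat -> X}
  {Lk : nat -> 'I_m -> nat} {xi : nat -> forall i, nat -> 'rV[R]_(n i)}
  {sigma : nat -> forall i, nat -> 'rV[R]_(q i)}
  {d : nat -> forall i, nat -> 'rV[R]_(n i)} {lambda : nat -> 'I_m -> nat -> R}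
  (run : CBGGP_run Om S f gradf h beta delta L x z Lk xi sigma d lambda).

Lemma submxrow_inner_point k (i : 'I_m) l :
  submxrow (inner_point x xi k i l) i = xi k i l.
Proof. by rewrite mxrowK ltnn. Qed.

Lemma inner_pointS k (i : 'I_m) l : (l < Lk k i)%N ->
  inner_point x xi k i l.+1 =
  inner_point x xi k i l + lambda k i l *: block_inj (d k i l).
Proof.
move=> lL; apply/mxrowP => j; rewrite submxrowD submxrowZ.
rewrite ![submxrow (inner_point _ _ _ _ _) _]mxrowK.
have [<-|ij] := eqVneq i j.
  by rewrite ltnn submxrow_block_inj (run_update run).
rewrite submxrow_block_inj_neq// scaler0 addr0.
by case: ltngtP => // /val_inj ji; rewrite ji eqxx in ij.
Qed.

(** With blocks numbered from 0, the inner loop on block [i] leads from [z k i] to [z k i.+1]. The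
    first block is separate because [run_z] only describes [z] at successors. *)
Lemma inner_point0 k (i : 'I_m) : inner_point x xi k i 0 = z k i.
Proof.
case iE: (i : nat) => [|i'].
  rewrite (run_z0 run); apply/mxrowP => j; rewrite mxrowK iE ltn0.
  by case: ifP => // _; rewrite (run_xi0 run).
have i'm : (i' < m)%N by rewrite -ltnS -iE ltnW// ltnS.
rewrite (run_z run k (Ordinal i'm)); apply/mxrowP => j.
rewrite !mxrowK /= iE ltnS.
by case: leqP => // _; case: ifP => // _; rewrite (run_xi0 run).
Qed.

Lemma inner_point_Lk k (i : 'I_m) : inner_point x xi k i (Lk k i) = z k i.+1.
Proof.
rewrite (run_z run); apply/mxrowP => j; rewrite !mxrowK.
case: ltngtP => // /val_inj ->; by rewrite (run_block run).
Qed.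

Lemma inner_point_decrease k (i : 'I_m) l : (l < Lk k i)%N ->
  block_prod Om (inner_point x xi k i l) ->
  block_prod Om (inner_point x xi k i l.+1) /\
  f (inner_point x xi k i l.+1) <= f (inner_point x xi k i l).
Proof.
move=> lL Omy; have Ss := run_sigma run lL.
have [l0 l1 al] := armijo_step_le (run_linesearch run lL).
have cOm : @convex_set R 'rV[R]_(n i) (Om i) := factor_convex Omy Om_convex.
have dE : d k i l = block_proj Om h (inner_point x xi k i l) (sigma k i l) -
    submxrow (inner_point x xi k i l) i.
  by rewrite submxrow_inner_point (run_direction run).
rewrite inner_pointS//; split; last first.
  rewrite (le_trans al)// gerDl mulr_ge0_le0//.
    by rewrite mulr_ge0 ?(ltW l0)//; case/andP: beta01 => /ltW.
  by rewrite dE; exact: direction_descent.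
have [[Omp _] _] := block_proj_min Ss Omy.
have := convex_set_segment (t := lambda k i l) Om_convex Omy
  ((block_prod_set_block _ Omy).2 Omp).
rewrite /set_block -dE addrAC subrr add0r; apply.
by rewrite ltW.
Qed.

Lemma inner_point_feasible k (i : 'I_m) l : (l <= Lk k i)%N ->
  block_prod Om (z k i) ->
  block_prod Om (inner_point x xi k i l) /\
  f (inner_point x xi k i l) <= f (z k i).
Proof.
elim: l => [_|l IH lL] Omz; first by rewrite inner_point0.
have [Omy fy] := IH (ltnW lL) Omz.
by have [? /le_trans] := inner_point_decrease lL Omy; split=> //; auto.
Qed.

Lemma inner_point_ge k (i : 'I_m) l : (l <= Lk k i)%N ->
  block_prod Om (z k i) -> f (z k i.+1) <= f (inner_point x xi k i l).
Proof.
move=> lL Omz; rewrite -inner_point_Lk -(subnKC lL).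
have : (l + (Lk k i - l) <= Lk k i)%N by rewrite subnKC.
elim: (Lk k i - l)%N => [|j IH]; first by rewrite addn0.
rewrite addnS => ljL.
have [Omy _] := inner_point_feasible (ltnW ljL) Omz.
have [_ /le_trans] := inner_point_decrease ljL Omy; apply.
exact: IH (ltnW ljL).
Qed.

(** Feasibility of [x k] is assumed here because it is proved by induction on [k], with this lemma
    as the inductive step. *)
Lemma z_feasible k i : (i <= m)%N -> block_prod Om (x k) ->
  block_prod Om (z k i) /\ f (z k i) <= f (x k).
Proof.
move=> im Omx; elim: i im => [_|i IH im]; first by rewrite (run_z0 run).
have [Omz fz] := IH (ltnW im).
have := inner_point_feasible (i := Ordinal im) (leqnn (Lk k _)) Omz.
by rewrite inner_point_Lk/= => -[Omz' /le_trans]; split=> //; auto.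
Qed.

Lemma x_feasible k : block_prod Om (x k).
Proof.
elim: k => [|k IH]; first exact: run_init run.
by rewrite (run_next run); have [] := z_feasible (leqnn m) IH.
Qed.

Lemma z_ge k i : (i <= m)%N -> f (x k.+1) <= f (z k i).
Proof.
move=> im; rewrite (run_next run) -(subnKC im).
have : (i + (m - i) <= m)%N by rewrite subnKC.
elim: (m - i)%N => [|j IH]; first by rewrite addn0.
rewrite addnS => ijm.
have [Omz _] := z_feasible (k := k) (ltnW ijm) (x_feasible k).
have := inner_point_ge (i := Ordinal ijm) (leq0n _) Omz.
by rewrite inner_point0 => /le_trans; apply; exact: IH (ltnW ijm).
Qed.

(** Bounds the decrease of every single inner step by that of the whole cycle,
    [f (x k) - f (x k.+1)]. *)
Lemma inner_point_bounds k (i : 'I_m) l : (l <= Lk k i)%N ->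
  block_prod Om (inner_point x xi k i l) /\
  f (x k.+1) <= f (inner_point x xi k i l) <= f (x k).
Proof.
move=> lL; have [Omz fz] := z_feasible (ltnW (ltn_ord i)) (x_feasible k).
have [Omy fy] := inner_point_feasible lL Omz; split=> //.
by rewrite (le_trans fy fz) (le_trans (z_ge _ (ltn_ord i)))// inner_point_ge.
Qed.

(** * Convergence of the objective values *)

Context {xbar : X} {phi : nat -> nat} (phi_incr : increasing_seq phi)
  (x_phi : x (phi k) @[k --> \oo] --> xbar).

Lemma limit_feasible : block_prod Om xbar.
Proof.
by apply: closed_cvg Om_closed _ _ x_phi; apply: nearW => k; exact: x_feasible.
Qed.

Lemma f_x_nonincreasing k l : (k <= l)%N -> f (x l) <= f (x k).
Proof.
move=> /subnKC <-; elim: (l - k)%N => [|j IH]; first by rewrite addn0.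
rewrite addnS (le_trans _ IH)// -(run_z0 run (k + j)%N).
exact: z_ge.
Qed.

(** The values are nonincreasing, so the limit along [phi] bounds all of them from below, and one
    value close to it forces all later ones to be close. *)
Lemma f_x_cvg : f (x k) @[k --> \oo] --> f xbar.
Proof.
have f_phi : f (x (phi k)) @[k --> \oo] --> f xbar.
  apply: (within_continuous_cvg (C1_on_continuous f_C1)) limit_feasible _ x_phi.
  by apply: nearW => k; exact: x_feasible.
have f_ge k : f xbar <= f (x k).
  apply: ler_cvg_near f_phi (cvg_cst (f (x k))) _.
  exists k => // l /= kl; apply: f_x_nonincreasing.
  exact: leq_trans kl (geq_increasing_seq l phi_incr).
apply/cvgrPdist_le => e e0.
have /cvgrPdist_le/(_ e e0)/filter_ex[j] := f_phi.
rewrite ler_distlC => /andP[_ fj].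
exists (phi j) => // k /= jk.
rewrite distrC ger0_norm ?subr_ge0// lerBlDl.
exact: le_trans (f_x_nonincreasing jk) fj.
Qed.

(** * Propagation of the limit through inner steps and blocks *)

Context {U : set_system nat} {UU : UltraFilter U}
  (U_oo : \oo `<=` U) (x_U : x k @[k --> U] --> xbar)
  (S_compact : compact (block_prod S)).

Lemma f_x_decrease_cvg : f (x k) - f (x k.+1) @[k --> U] --> (0 : R).
Proof.
(* The shift is handled along [\oo], where the whole sequence of values converges; along [U] nothing
   is known about [x k.+1]. *)
have fS_cvg : [sequence f (x n.+1)]_n @ \oo --> f xbar.
  by rewrite (cvg_shiftS (fun k => f (x k))); exact: f_x_cvg.
have df_cvg : f (x k) - f (x k.+1) @[k --> \oo] --> (0 : R).
  by rewrite -(subrr (f xbar)); apply: cvgB fS_cvg; exact: f_x_cvg.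
by move=> P /df_cvg; exact: U_oo.
Qed.

Lemma factor_S_compact (i : 'I_m) : compact (S i).
Proof.
(* Every block makes at least one inner step, so the first parameters of cycle 0 form a point of the
   product of the [S j]. *)
have L0 (j : 'I_m) : (0 < Lk 0 j)%N by have /andP[] := run_Lk run 0 j.
apply: (factor_compact (x := \mxrow_j sigma 0%N j 0%N)) => // j.
by rewrite mxrowK; exact: (run_sigma run (L0 j)).
Qed.

(** The number of inner steps varies with [k]; [minn] freezes the inner index once the loop on block
    [i] has ended, so that a fixed [l] makes sense for all [k]. *)
Lemma inner_step_cvg (i : 'I_m) l :
  U [set k | (l < Lk k i)%N] ->
  inner_point x xi k i (minn l (Lk k i)) @[k --> U] --> xbar ->
  inner_point x xi k i (minn l.+1 (Lk k i)) @[k --> U] --> xbar /\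
  exists2 s, S i s & block_proj Om h xbar s = submxrow xbar i.
Proof.
move=> Ul yl.
have [||||||yS [s Ss sE]] := @armijo_update_cvg nat U UU i
  (fun k => sigma k i l) (fun k => inner_point x xi k i l) xbar
  (fun k => lambda k i l).
- exact: factor_S_compact.
- by apply: filterS Ul => k /(run_sigma run).
- by apply: filterS Ul => k /ltnW/inner_point_bounds[].
- apply: cvg_trans yl; apply: near_eq_cvg.
  by apply: filterS Ul => k /= /ltnW/minn_idPl ->.
- apply: filterS Ul => k lL; rewrite submxrow_inner_point.
  by rewrite -(run_direction run)//; exact: (run_linesearch run lL).
- apply: (squeeze_cvgr (f := fun=> 0) (h := fun k => f (x k) - f (x k.+1)));
    [|exact: cvg_cst|exact: f_x_decrease_cvg].
  apply: filterS Ul => k lL; rewrite submxrow_inner_point.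
  rewrite -(run_direction run)// -inner_pointS//.
  have [Omy /andP[_ f1]] := inner_point_bounds (ltnW lL).
  have [_ /andP[f2 _]] := inner_point_bounds lL.
  have [_ f3] := inner_point_decrease lL Omy.
  by rewrite subr_ge0 f3 lerB.
split; last by exists s.
apply: cvg_trans yS; apply: near_eq_cvg; apply: filterS Ul => k lL.
rewrite submxrow_inner_point -(run_direction run)// -inner_pointS//.
by rewrite (minn_idPl lL).
Qed.

Lemma inner_point_cvg (i : 'I_m) l :
  z k i @[k --> U] --> xbar ->
  inner_point x xi k i (minn l (Lk k i)) @[k --> U] --> xbar.
Proof.
move=> z_cvg; elim: l => [|l IH].
  apply: cvg_trans z_cvg; apply: near_eq_cvg; apply: nearW => k.
  by rewrite min0n inner_point0.
(* The ultrafilter decides whether step [l] is performed: if so, the step preserves the limit; if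
   not, the index is already frozen. *)
have [Ul|Ul] := in_ultra_setVsetC [set k | (l < Lk k i)%N] UU.
  by have [] := inner_step_cvg Ul IH.
apply: cvg_trans IH; apply: near_eq_cvg; apply: filterS Ul => k /= /negP.
by rewrite -leqNgt => Ll; rewrite !(minn_idPr _)// ltnW.
Qed.

Lemma z_cvg i : (i <= m)%N -> z k i @[k --> U] --> xbar.
Proof.
elim: i => [_|i IH im].
  by rewrite (_ : z^~ 0%N = x)//; apply/funext => k; rewrite (run_z0 run).
(* The bound [L] does not depend on [k], and at that index every inner loop has ended. *)
apply: cvg_trans (inner_point_cvg (i := Ordinal im)
  (L (Ordinal im)) (IH (ltnW im))).
apply: near_eq_cvg; apply: nearW => k.
have /andP[_ LkL] := run_Lk run k (Ordinal im).
by rewrite (minn_idPr LkL) inner_point_Lk.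
Qed.

Lemma limit_stationary : stationary (block_prod Om) gradf xbar.
Proof.
split=> [|y Omy]; first exact: limit_feasible.
rewrite dot_blocks; apply: sumr_ge0 => i _; rewrite submxrowB.
(* Step 0 is always performed, and its limit shows that [xbar] is fixed by a projection on block
   [i]. *)
have ULk : U [set k | (0 < Lk k i)%N].
  by apply: nearW => k; have /andP[] := run_Lk run k i.
have [_ [s Ss sE]] := inner_step_cvg ULk
  (inner_point_cvg 0 (z_cvg (ltnW (ltn_ord i)))).
apply: (block_proj_stationary Ss limit_feasible _ sE (Omy i)).
exact: factor_convex limit_feasible Om_convex.
Qed.

End Method.

Theorem theorem1 (R : realType) (m : nat) (n q : 'I_m -> nat)
    (Om : forall i, set 'rV[R]_(n i))
    (Om_closed : closed (block_prod Om))
    (Om_convex : @convex_set R 'rV[R]_(\sum_i n i) (block_prod Om))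
    (f : 'rV[R]_(\sum_i n i) -> R)
    (gradf : 'rV[R]_(\sum_i n i) -> 'rV[R]_(\sum_i n i))
    (f_C1 : C1_on (block_prod Om) f gradf)
    (S : forall i, set 'rV[R]_(q i))
    (S_compact : compact (block_prod S))
    (hs : 'rV[R]_(\sum_i q i) ->
          'rV[R]_(\sum_i n i) -> 'rV[R]_(\sum_i n i) -> R)
    (h : forall i, 'rV[R]_(q i) -> 'rV[R]_(n i) -> 'rV[R]_(\sum_i n i) -> R)
    (gradh : forall i, 'rV[R]_(q i) ->
       'rV[R]_(n i + \sum_j n j) -> 'rV[R]_(n i + \sum_j n j))
    (h_metric : block_separable_metric Om S gradf hs h gradh)
    (beta delta : R)
    (beta01 : 0 < beta < 1) (delta01 : 0 < delta < 1)
    (L : 'I_m -> nat) (L_gt0 : forall i, (0 < L i)%N)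
    (x : nat -> 'rV[R]_(\sum_i n i))
    (z : nat -> nat -> 'rV[R]_(\sum_i n i))
    (Lk : nat -> 'I_m -> nat)
    (xi : nat -> forall i, nat -> 'rV[R]_(n i))
    (sigma : nat -> forall i, nat -> 'rV[R]_(q i))
    (d : nat -> forall i, nat -> 'rV[R]_(n i))
    (lambda : nat -> 'I_m -> nat -> R)
    (run : CBGGP_run Om S f gradf h beta delta L x z Lk xi sigma d lambda)
    (xbar : 'rV[R]_(\sum_i n i))
    (xbar_limit : subseq_limit_point x xbar) :
  (forall i, (1 <= i <= m.-1)%N -> subseq_limit_point (fun k => z k i) xbar) /\
  stationary (block_prod Om) gradf xbar.
Proof.
have [phi phi_incr x_phi] := xbar_limit.
(* A limit along the filter [phi @ \oo] is a limit of the subsequence given by [phi], and this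
   filter refines [\oo]. *)
have phi_oo : \oo `<=` phi @ \oo.
  move=> P [N _ NP]; exists N => // k /= Nk; apply: NP => /=.
  exact: leq_trans Nk (geq_increasing_seq k phi_incr).
have x_cvg (U : set_system nat) : phi @ \oo `<=` U -> x k @[k --> U] --> xbar.
  by move=> phiU P /x_phi; exact: phiU.
split=> [i /andP[_ im]|].
  (* The same subsequence serves for every [i]: the limit holds along each ultrafilter finer than
     [phi @ \oo], hence along that filter. *)
  exists phi => //.
  apply: (@cvg_ultra _ (phi @ \oo) _ _ (fun k => z k i)) => U UU phiU.
  apply: (z_cvg h_metric Om_closed Om_convex f_C1 beta01 delta01 run phi_incr
    x_phi) => //.
  - by move=> P /phi_oo; exact: phiU.
  - exact: x_cvg.
  - exact: leq_trans im (leq_pred m).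
(* Stationarity does not mention the filter, so a single ultrafilter suffices. *)
have [U [UU phiU]] :=
  ultraFilterLemma (fmap_proper_filter phi eventually_filter).
apply: (limit_stationary (U := U) h_metric Om_closed Om_convex f_C1 beta01
  delta01 run phi_incr x_phi) => //.
- by move=> P /phi_oo; exact: phiU.
- exact: x_cvg.
Qed.
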